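(* Let $G$ be a weakly connected graph (finite edge-labelled acyclic directed multigraph), let $X$ be a nonempty proper subset of $V(G)$, and let $Y=V(G)\setminus X$. Suppose that $G\{[X,Y]\}$ (with its ends in $X$ and its ends in $Y$ as partite sets) is a clean bipartite subgraph of $G$, and that the arcs of $G/X$ and $G/Y$ corresponding to the arcs of $[X,Y]$ are the only synchronising arcs of $G/X$ and $G/Y$ (with respect to each other). If $S'(G)\subseteq X$ and $[X,Y]$ has no backward arcs, then $$G\cong \mathrm{VRSP}(G/Y,\,G/X).$$
   Context: **Graphs.** A graph $G$ is a finite edge-labelled acyclic directed multigraph: a vertex set $V(G)$, an arc set $A(G)$, a set $L(G)$ of label pairs (the label pairs carried by arcs of $G$), an incidence map $\mu:A(G)\to V(G)\times V(G)$, where $\mu(a)=(u,v)$ means that $a$ has tail $u$ and head $v$ (its two ends), and a labelling $\lambda:A(G)\to L(G)$, where $\lambda(a)=(\ell(a),t(a))$ consists of a string $\ell(a)$ and a positive real $t(a)$. Two different arcs with the same tail and the same head are assumed to have different label pairs; whenever a construction produces several arcs with the same tail, head and label pair, they are replaced by a single one. $G$ is weakly connected if its underlying undirected graph is connected. $S'(G)$ is the set of vertices of in-degree $0$. **Levels.** $S^0(G)=S'(G)$; $S^1(G)$ is the set of vertices of in-degree $0$ after deleting $S^0(G)$ and all arcs with tail in $S^0(G)$; and so on. A vertex in $S^j(G)$ is at level $j$. In particular, level $0$ means in-degree $0$. **Arcs between sets.** For disjoint nonempty $X,Y\subseteq V(G)$, $[X,Y]$ is the set of arcs with one end in $X$ and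 the other in $Y$; such an arc is forward if its head is in $Y$ and backward otherwise. For a set $A'$ of arcs, $G\{A'\}$ is the arc-induced subgraph, with arc set $A'$ and with vertices the ends of arcs of $A'$. **Clean bipartite graphs.** A graph is bipartite, written $B(V_1,V_2)$, if its vertex set is partitioned into nonempty sets $V_1,V_2$ such that every arc has its ends in different sets. It is complete if for all $x\in V_1$, $y\in V_2$ there is an arc with $\mu(a)=(x,y)$ or $\mu(a)=(y,x)$. $B(V_1,V_2)$ is clean if (i) for every label pair occurring on its arcs, the subgraph arc-induced by all arcs with that label pair is a complete bipartite graph $B(V_1',V_2')$ with $V_1'\subseteq V_1$, $V_2'\subseteq V_2$, and (ii) $[V_1,V_2]$ has no backward arcs or $[V_1,V_2]$ has no forward arcs. **Contraction.** For a nonempty proper subset $X$ of $V(G)$, $G/X$ is obtained by replacing $X$ by a new vertex $\tilde x$, deleting all arcs with both ends in $X$, and replacing each arc with exactly one end in $X$ by an arc with the same label pair in which that end is replaced by $\tilde x$. **Synchronising arcs.** For graphs $G_1,G_2$, an arc $a$ of $G_1$ is synchronising with respect to $G_2$ if some arc $b$ of $G_2$ has $\lambda(b)=\lambda(a)$; similarly with the roles exchanged. **Products.** Let $G_1,G_2$ be graphs. The Cartesian product $G_1\,\Box\,G_2$ has vertex set $V(G_1)\times V(G_2)$; each arc $a\in A(G_1)$ with $\mu(a)=(v_1,w_1)$ and each $v_2\in V(G_2)$ give an arc from $(v_1,v_2)$ to $(w_1,v_2)$ with label pair $\lambda(a)$, and each arc $a\in A(G_2)$ with $\mu(a)=(v_2,w_2)$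 and each $v_1\in V(G_1)$ give an arc from $(v_1,v_2)$ to $(v_1,w_2)$ with label pair $\lambda(a)$. The intermediate product $G_1\boxtimes G_2$ has the same vertex set; its arcs are the arcs of $G_1\,\Box\,G_2$ arising from non-synchronising arcs of $G_1$ or $G_2$ (label pair not in $L(G_2)$, respectively $L(G_1)$), together with, for each pair $a_1\in A(G_1)$, $a_2\in A(G_2)$ with $\lambda(a_1)=\lambda(a_2)$, $\mu(a_1)=(v_1,w_1)$, $\mu(a_2)=(v_2,w_2)$, an arc from $(v_1,v_2)$ to $(w_1,w_2)$ with label pair $\lambda(a_1)$. The vertex-removing synchronised product $\mathrm{VRSP}(G_1,G_2)$ is obtained from $G_1\boxtimes G_2$ by removing every vertex that has level $0$ in the current graph but level $>0$ in $G_1\,\Box\,G_2$, together with all arcs with that vertex as tail, and repeating this until no such vertices remain. **Isomorphism.** $G\cong H$ means there is a bijection $\phi:V(G)\to V(H)$ such that for all $u,v\in V(G)$ and every label pair, there is an arc $a\in A(G)$ with $\mu(a)=(u,v)$ and that label pair if and only if there is an arc $b\in A(H)$ with $\mu(b)=(\phi(u),\phi(v))$ and that label pair. *)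

(* Defs.v *)
From HB Require Import structures.
From Stdlib Require Import String Ascii.
From mathcomp Require Import all_boot all_order all_algebra.
From mathcomp Require Import reals interval_inference.

Set Implicit Arguments.
Unset Strict Implicit.
Unset Printing Implicit Defensive.

HB.instance Definition _ := Countable.copy ascii (can_type ascii_nat_embedding).
HB.instance Definition _ :=
  Countable.copy string (can_type string_of_list_ascii_of_string).

Definition label_pair (R : realType) : choiceType :=
  (string * {posnum R}%R)%type.

(* Acyclicity is not a field: a contraction of an acyclic multidigraph can have
   directed cycles, so it is the separate predicate [acyclic] below. *)
Record multidigraph (L : choiceType) := Multidigraph {
  vertex_of : finType;
  arc_of : finType;
  mu : arc_of -> vertex_of * vertex_of;
  lab : arc_of -> L;
  mu_lab_inj : injective (fun a => (mu a, lab a))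
}.

Section Graphs.
Variable L : choiceType.
Implicit Type G H : multidigraph L.

Definition arc_tail G (a : arc_of G) : vertex_of G := (mu a).1.
Definition arc_head G (a : arc_of G) : vertex_of G := (mu a).2.

Definition adj G : rel (vertex_of G) := fun u v => [exists a : arc_of G, mu a == (u, v)].
Arguments adj : clear implicits.

Definition acyclic G : Prop :=
  forall c : seq (vertex_of G), c != [::] -> ~~ cycle (adj G) c.

Definition weakly_connected G : Prop :=
  forall u v : vertex_of G,
    connect (fun x y => adj G x y || adj G y x) u v.

Definition in_degree G (v : vertex_of G) : nat :=
  #|[set a : arc_of G | arc_head a == v]|.

Definition sources G : {set vertex_of G} := [set v | in_degree v == 0].

(* The vertices outside [D] of in-degree 0 once [D] and all arcs with tail in
   [D] are deleted. *)
Definition sources_without G (D : {set vertex_of G}) : {set vertex_of G} :=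
  [set v in ~: D | #|[set a : arc_of G | arc_head a == v & arc_tail a \notin D]| == 0].

Fixpoint below_level G (j : nat) : {set vertex_of G} :=
  if j is i.+1 then below_level G i :|: sources_without (below_level G i)
  else set0.

Definition level_set G (j : nat) : {set vertex_of G} :=
  sources_without (below_level G j).

(* In an acyclic multidigraph every vertex lies in exactly one [level_set G j],
   and then j < #|vertex_of G|. *)
Definition level G (v : vertex_of G) : nat :=
  find (fun j => v \in level_set G j) (iota 0 #|vertex_of G|).

Lemma level_set0 G : level_set G 0 = sources G.
Proof.
apply/setP=> v; rewrite !inE /=; congr (_ == 0).
by apply: eq_card => a; rewrite !inE andbT.
Qed.

Lemma level_eq0 G (v : vertex_of G) : (level v == 0) = (v \in sources G).
Proof.
rewrite /level; case E: #|vertex_of G| => [|n].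
  by move: (max_card (pred1 v)); rewrite card1 E.
by rewrite [iota 0 _]/= [find _ _]/= level_set0; case: ifP.
Qed.

Definition arcs_between G (X Y : {set vertex_of G}) : {set arc_of G} :=
  [set a | ((arc_tail a \in X) && (arc_head a \in Y)) || ((arc_tail a \in Y) && (arc_head a \in X))].

Definition no_backward G (X Y : {set vertex_of G}) : Prop :=
  forall a : arc_of G, a \in arcs_between X Y -> arc_head a \in Y.

Definition no_forward G (X Y : {set vertex_of G}) : Prop :=
  forall a : arc_of G, a \in arcs_between X Y -> arc_head a \notin Y.

Section Subgraph.
Variables (G : multidigraph L) (W : {set vertex_of G}) (B : {set arc_of G}).
Hypothesis BW : forall a, a \in B -> (arc_tail a \in W) && (arc_head a \in W).

Definition sub_mu (a : {a : arc_of G | a \in B}) :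
    {v : vertex_of G | v \in W} * {v : vertex_of G | v \in W} :=
  let: conj tW hW := andP (BW (valP a)) in
  (exist _ (arc_tail (val a)) tW, exist _ (arc_head (val a)) hW).

Lemma sub_mu_lab_inj : injective (fun a => (sub_mu a, lab (val a))).
Proof.
move=> a b; rewrite /sub_mu.
case: (andP _) => ta ha; case: (andP _) => tb hb [et eh el].
apply/val_inj/(@mu_lab_inj _ G); congr (_, _) => //.
by rewrite [LHS]surjective_pairing [RHS]surjective_pairing; congr (_, _).
Qed.

Definition subgraph : multidigraph L := Multidigraph sub_mu_lab_inj.
End Subgraph.

Definition ends G (A : {set arc_of G}) : {set vertex_of G} :=
  [set v | [exists a in A, (v == arc_tail a) || (v == arc_head a)]].

Lemma ends_tail_head G (A : {set arc_of G}) a :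
  a \in A -> (arc_tail a \in ends A) && (arc_head a \in ends A).
Proof.
by move=> aA; rewrite !inE; apply/andP; split; apply/existsP; exists a;
   rewrite aA eqxx ?orbT.
Qed.

Definition arc_induced G (A : {set arc_of G}) : multidigraph L :=
  subgraph (@ends_tail_head G A).

Definition arcs_within G (W : {set vertex_of G}) : {set arc_of G} :=
  [set a | (arc_tail a \in W) && (arc_head a \in W)].

Lemma arcs_within_tail_head G (W : {set vertex_of G}) a :
  a \in arcs_within W -> (arc_tail a \in W) && (arc_head a \in W).
Proof. by rewrite inE. Qed.

Definition vertex_induced G (W : {set vertex_of G}) : multidigraph L :=
  subgraph (@arcs_within_tail_head G W).

Definition bipartite G (V1 V2 : {set vertex_of G}) : Prop :=
  [/\ V1 != set0, V2 != set0, V1 :&: V2 = set0, V1 :|: V2 = setT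
    & forall a : arc_of G, (arc_tail a \in V1) != (arc_head a \in V1)].

Definition complete_bipartite G (V1 V2 : {set vertex_of G}) : Prop :=
  bipartite V1 V2 /\
  forall x y, x \in V1 -> y \in V2 ->
    exists a : arc_of G, mu a = (x, y) \/ mu a = (y, x).

Definition arcs_labelled G (l : L) : {set arc_of G} := [set a | lab a == l].
Arguments arcs_labelled : clear implicits.

Definition clean_bipartite G (V1 V2 : {set vertex_of G}) : Prop :=
  [/\ bipartite V1 V2,
      forall l : L, (exists a : arc_of G, lab a = l) ->
        exists V1' V2' : {set vertex_of (arc_induced (arcs_labelled G l))},
          [/\ complete_bipartite V1' V2',
              [set val v | v in V1'] \subset V1
            & [set val v | v in V2'] \subset V2]
    & no_backward V1 V2 \/ no_forward V1 V2].

(* The multidigraph whose arcs are the given (tail, head, label pair) triples;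
   arcs with the same tail, head and label pair are merged. *)
Section OfTriples.
Variables (V : finType) (s : seq (V * V * L)).

Lemma of_triples_inj :
  injective (fun a : seq_sub s => ((ssval a).1, (ssval a).2)).
Proof.
by move=> a b [e1 e2]; apply: val_inj => /=;
   rewrite [LHS]surjective_pairing e1 e2 -surjective_pairing.
Qed.

Definition of_triples : multidigraph L :=
  @Multidigraph L V (seq_sub s) (fun a => (ssval a).1) (fun a => (ssval a).2)
    of_triples_inj.
End OfTriples.

(* [None] is the vertex replacing [X], and [insub v] is [None] iff v \in X. *)
Definition contract_vertex G (X : {set vertex_of G}) (v : vertex_of G) :
  option {v : vertex_of G | v \notin X} := insub v.

Definition contract_triple G (X : {set vertex_of G}) (a : arc_of G) :=
  ((contract_vertex X (arc_tail a), contract_vertex X (arc_head a)), lab a).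

Definition contract G (X : {set vertex_of G}) : multidigraph L :=
  of_triples [seq contract_triple X a | a <- enum (~: arcs_within X)].

Definition corresponds G (X : {set vertex_of G}) (b : arc_of (contract X)) (a : arc_of G)
  : Prop := a \notin arcs_within X /\ (mu b, lab b) = contract_triple X a.

Definition synchronising G H (a : arc_of G) : bool :=
  [exists b : arc_of H, lab b == lab a].

Definition move_left G H (a : arc_of G) (v : vertex_of H) :
    (vertex_of G * vertex_of H) * (vertex_of G * vertex_of H) * L :=
  ((arc_tail a, v), (arc_head a, v), lab a).

Definition move_right G H (v : vertex_of G) (a : arc_of H) :
    (vertex_of G * vertex_of H) * (vertex_of G * vertex_of H) * L :=
  ((v, arc_tail a), (v, arc_head a), lab a).

Definition move_both G H (a : arc_of G) (b : arc_of H) :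
    (vertex_of G * vertex_of H) * (vertex_of G * vertex_of H) * L :=
  ((arc_tail a, arc_tail b), (arc_head a, arc_head b), lab a).

Definition cartesian_product G H : multidigraph L :=
  @of_triples (vertex_of G * vertex_of H)%type
    ([seq move_left a v | a <- enum (arc_of G), v <- enum (vertex_of H)] ++
     [seq move_right v b | v <- enum (vertex_of G), b <- enum (arc_of H)]).

Definition intermediate_product G H : multidigraph L :=
  @of_triples (vertex_of G * vertex_of H)%type
    ([seq move_left a v | a <- [seq a <- enum (arc_of G) | ~~ synchronising H a],
                          v <- enum (vertex_of H)] ++
     [seq move_right v b | v <- enum (vertex_of G),
                           b <- [seq b <- enum (arc_of H) | ~~ synchronising G b]] ++
     [seq move_both ab.1 ab.2 | ab <- enum {: arc_of G * arc_of H} & lab ab.1 == lab ab.2]).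

(* The vertices of the current graph [W] that must be removed. A removed vertex
   has in-degree 0 in the current graph, so deleting it with the arcs of which
   it is the arc_tail leaves the vertex-induced subgraph on the other vertices. *)
Definition vrsp_removed G H (W : {set vertex_of (intermediate_product G H)}) :
    {set vertex_of (intermediate_product G H)} :=
  [set val w | w in [set w : vertex_of (vertex_induced W) |
     (level w == 0) && (0 < level (val w : vertex_of (cartesian_product G H)))]].

(* Each round removes a vertex or changes nothing, so #|V(G) x V(H)| rounds
   reach the point where no vertex is left to remove. *)
Definition vrsp_vertices G H : {set vertex_of (intermediate_product G H)} :=
  iter #|vertex_of (intermediate_product G H)|
    (fun W => W :\: vrsp_removed W) setT.

Definition VRSP G H : multidigraph L := vertex_induced (vrsp_vertices G H).

Definition isomorphic G H : Prop :=
  exists phi : vertex_of G -> vertex_of H, bijective phi /\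
    forall (u v : vertex_of G) (l : L),
      (exists a : arc_of G, mu a = (u, v) /\ lab a = l) <->
      (exists b : arc_of H, mu b = (phi u, phi v) /\ lab b = l).

End Graphs.

(* Main.v *)
Require Import Defs.
From mathcomp Require Import all_boot all_order all_algebra reals.

(** As no arc goes from [Y] to [X], the arcs of [G/Y] are the arcs of [G] with
    tail in [X], and those of [G/X] are the arcs of [G] with head in [Y]; the
    arcs from [X] to [Y] occur in both.  The isomorphism sends a vertex [u] to
    the pair of its images in [G/Y] and [G/X]; it maps x in [X] to (x, x~) and
    y in [Y] to (y~, y), where x~ and y~ are the vertices replacing [X] and [Y].

    On these vertices the intermediate product has the arcs of [G]
    ([arc_product_image]): arcs inside [X] or inside [Y] are not synchronising
    and give moves in one coordinate, while an arc from (x, x~) to (y~, y) with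
    label pair l exists when l occurs on some arc from x to [Y] and on some arc
    from [X] to y; because [G{[X,Y]}] is clean, l then occurs on an arc from x
    to y ([clean_exchange]).

    It remains to see that the surviving vertices are exactly these
    ([vrsp_image]).  The removal process stops at a set in which every vertex is
    a source of the Cartesian product or has an in-neighbour in the set
    ([vrsp_stable]), and it never touches a set with this property
    ([vrsp_closed]).  The image of [V(G)] has this property: a source of [G] lies
    in [X] and is sent to a source of the Cartesian product, and the image of any
    other vertex inherits an in-neighbour from [G].  The remaining vertices are
    (y~, x~) and the (x, y).  None is a source of the Cartesian product, since
    there is an arc from [X] to [Y] and [Y] contains no source of [G].  The
    vertex (y~, x~) has no in-arc in the intermediate product; all in-neighbours
    of (x, y) are again of the form (x', y'), with smaller total rank in the
    acyclic order of [G], so all of them disappear by induction. *)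

Set Implicit Arguments.
Unset Strict Implicit.
Unset Printing Implicit Defensive.

(** * Arcs as labelled pairs of vertices *)

Section Arcs.
Variable L : choiceType.
Implicit Types G H : multidigraph L.

(** There is an arc from [u] to [v] with label pair [l]; by [mu_lab_inj] such an
    arc is unique. *)
Definition has_arc G (u v : vertex_of G) (l : L) : Prop :=
  exists a : arc_of G, mu a = (u, v) /\ lab a = l.

(** [l] is the label pair of some arc of [G]. *)
Definition has_label G (l : L) : Prop := exists u v : vertex_of G, has_arc u v l.

Lemma has_arc_mu G (a : arc_of G) : has_arc (arc_tail a) (arc_head a) (lab a).
Proof. by exists a; rewrite -surjective_pairing. Qed.

Lemma has_labelP G (l : L) : has_label G l <-> exists a : arc_of G, lab a = l.
Proof.
split=> [[u [v [a [_ <-]]]]|[a <-]]; first by exists a.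
by exists (arc_tail a), (arc_head a); exact: has_arc_mu.
Qed.

Lemma has_label_arc G u v l : @has_arc G u v l -> has_label G l.
Proof. by move=> a; exists u, v. Qed.

Lemma synchronisingP G H (a : arc_of G) :
  reflect (has_label H (lab a)) (synchronising H a).
Proof.
apply: (iffP existsP) => [[b /eqP e]|/has_labelP[b e]]; last by exists b; apply/eqP.
by apply/has_labelP; exists b.
Qed.

Lemma sourcesP G (v : vertex_of G) :
  reflect (forall u l, ~ has_arc u v l) (v \in sources G).
Proof.
rewrite inE cards_eq0; apply: (iffP eqP) => [e u l [a [ea _]]|h].
  by have := in_set0 a; rewrite -e inE /arc_head ea eqxx.
apply/setP => a; rewrite !inE; apply/negbTE/eqP => e.
by apply: (h (arc_tail a) (lab a)); rewrite -e; exact: has_arc_mu.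
Qed.

Lemma not_sourcesP G (v : vertex_of G) :
  v \notin sources G -> exists u l, has_arc u v l.
Proof.
rewrite inE cards_eq0 => /set0Pn[a]; rewrite inE => /eqP <-.
by exists (arc_tail a), (lab a); exact: has_arc_mu.
Qed.

Lemma has_arc_of_triples (V : finType) (s : seq (V * V * L)) (u v : V) l :
  @has_arc (of_triples s) u v l <-> (u, v, l) \in s.
Proof.
split=> [[a [/= eu <-]]|i].
  by rewrite -eu -surjective_pairing; exact: ssvalP.
by exists (SeqSub i).
Qed.

Lemma has_arc_vertex_induced G (W : {set vertex_of G})
    (u v : vertex_of (vertex_induced W)) l :
  has_arc u v l <-> has_arc (val u) (val v) l.
Proof.
split=> [[a [ea <-]]|[a [ea el]]].
  exists (val a); split=> //; move: ea.
  rewrite /mu /= /sub_mu; case: (andP _) => ta ha -[<- <-].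
  by rewrite /= -surjective_pairing.
have aW : a \in arcs_within W.
  by rewrite inE /arc_tail /arc_head ea /= (valP u) (valP v).
exists (exist _ a aW); split=> //.
rewrite /mu /= /sub_mu; case: (andP _) => ta ha.
by congr (_, _); apply: val_inj; rewrite /= /arc_tail /arc_head ea.
Qed.

(** * Contractions and products *)

Lemma contract_vertexE G (X : {set vertex_of G}) v :
  v \in X -> contract_vertex X v = None.
Proof. by move=> vX; apply: insubF; rewrite vX. Qed.

Lemma contract_vertex_None G (X : {set vertex_of G}) v :
  contract_vertex X v = None -> v \in X.
Proof. by rewrite /contract_vertex; case: insubP => // vX _; exact: contraNT vX. Qed.

Lemma contract_vertex_inj G (X : {set vertex_of G}) u v :
  v \notin X -> contract_vertex X u = contract_vertex X v -> u = v.
Proof.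
move=> vX; rewrite /contract_vertex (insubT (fun v => v \notin X) vX).
by case: insubP => //= w _ <- [->].
Qed.

Lemma has_arc_contract G (X : {set vertex_of G}) (p q : vertex_of (contract X)) l :
  has_arc p q l <->
  exists u v, [/\ has_arc u v l, ~~ ((u \in X) && (v \in X)),
    p = contract_vertex X u & q = contract_vertex X v].
Proof.
rewrite has_arc_of_triples; split=> [/mapP[a aX [-> -> ->]]|[u [v [[a [ea <-]] uv -> ->]]]].
  exists (arc_tail a), (arc_head a); split=> //; first exact: has_arc_mu.
  by move: aX; rewrite mem_enum !inE.
apply/mapP; exists a; first by rewrite mem_enum !inE /arc_tail /arc_head ea.
by rewrite /contract_triple /arc_tail /arc_head ea.
Qed.

Lemma corresponds_mu G (X : {set vertex_of G}) (b : arc_of (contract X)) a :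
  corresponds b a ->
  mu b = (contract_vertex X (arc_tail a), contract_vertex X (arc_head a)).
Proof. by case=> _ /(congr1 fst). Qed.

Lemma has_arc_cartesian G H (u1 v1 : vertex_of G) (u2 v2 : vertex_of H) l :
  @has_arc (cartesian_product G H) (u1, u2) (v1, v2) l <->
  (has_arc u1 v1 l /\ u2 = v2) \/ (u1 = v1 /\ has_arc u2 v2 l).
Proof.
rewrite has_arc_of_triples mem_cat; split=> [/orP[]|].
- by move=> /allpairsPdep[a [v [_ _ [-> -> -> <- ->]]]]; left; split=> //; exact: has_arc_mu.
- by move=> /allpairsPdep[v [a [_ _ [-> -> <- -> ->]]]]; right; split=> //; exact: has_arc_mu.
- move=> [[[a [ea <-]] <-]|[<- [a [ea <-]]]]; apply/orP; [left|right];
    apply/allpairsPdep; [exists a, u2|exists u1, a];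
    by split; rewrite ?mem_enum // /move_left /move_right /arc_tail /arc_head ea.
Qed.

Lemma has_arc_intermediate G H (u1 v1 : vertex_of G) (u2 v2 : vertex_of H) l :
  @has_arc (intermediate_product G H) (u1, u2) (v1, v2) l <->
  [\/ [/\ has_arc u1 v1 l, ~ has_label H l & u2 = v2],
      [/\ has_arc u2 v2 l, ~ has_label G l & u1 = v1] |
      has_arc u1 v1 l /\ has_arc u2 v2 l].
Proof.
rewrite has_arc_of_triples !mem_cat; split=> [/orP[|/orP[]]|].
- move=> /allpairsPdep[a [v [+ _ [-> -> -> <- ->]]]].
  rewrite mem_filter => /andP[/synchronisingP aH _].
  by constructor 1; split=> //; exact: has_arc_mu.
- move=> /allpairsPdep[v [a [_ + [-> -> <- -> ->]]]].
  rewrite mem_filter => /andP[/synchronisingP aG _].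
  by constructor 2; split=> //; exact: has_arc_mu.
- move=> /mapP[[a b]]; rewrite mem_filter /= => /andP[/eqP ab _] [-> -> -> -> ->].
  by constructor 3; split; [|rewrite ab]; exact: has_arc_mu.
- move=> [[[a [ea <-]] nl <-]|[[a [ea <-]] nl <-]|[[a [ea <-]] [b [eb el]]]].
  + apply/orP; left; apply/allpairsPdep; exists a, u2.
    split; [by rewrite mem_filter mem_enum andbT; apply/synchronisingP
           |by rewrite mem_enum|by rewrite /move_left /arc_tail /arc_head ea].
  + apply/orP; right; apply/orP; left; apply/allpairsPdep; exists u1, a.
    split; [by rewrite mem_enum|by rewrite mem_filter mem_enum andbT; apply/synchronisingP
           |by rewrite /move_right /arc_tail /arc_head ea].
  + apply/orP; right; apply/orP; right; apply/mapP; exists (a, b).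
      by rewrite mem_filter mem_enum andbT /= el.
    by rewrite /move_both /arc_tail /arc_head ea eb.
Qed.

(** * Ranks in acyclic graphs *)

(** The number of vertices from which [v] can be reached. *)
Definition rank G (v : vertex_of G) : nat := #|[set u | connect (@adj _ G) u v]|.

Lemma rank_lt G (u v : vertex_of G) l : acyclic G -> has_arc u v l -> rank u < rank v.
Proof.
move=> acG [a [ea _]]; have uv : adj u v by apply/existsP; exists a; apply/eqP.
apply/proper_card/properP; split.
  by apply/subsetP => w; rewrite !inE => wu; apply: connect_trans wu (connect1 uv).
exists v; rewrite !inE ?connect0 //; apply/connectP => -[p pp e].
by have := acG (v :: p) isT; rewrite /= rcons_path pp -e uv.
Qed.

(** * The vertices of the vertex-removing synchronised product *)

(** Iterating a deflationary set operator from the full set as many times as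
    there are elements reaches a fixed point. *)
Lemma iter_deflationary_fix (T : finType) (F : {set T} -> {set T}) :
  (forall W, F W \subset W) -> F (iter #|T| F setT) = iter #|T| F setT.
Proof.
move=> FW.
(* each application of [F] before a fixed point removes an element *)
have fix_or_small n : F (iter n F setT) = iter n F setT \/ #|iter n F setT| + n <= #|T|.
  elim: n => [|n [/= e|IHn] /=]; first by right; rewrite addn0 max_card.
    by left; rewrite !e.
  have [e|ne] := eqVneq (F (iter n F setT)) (iter n F setT); first by left; rewrite !e.
  right; rewrite addnS; apply: leq_trans IHn; rewrite ltn_add2r.
  by apply: proper_card; rewrite properEneq ne FW.
have [//|] := fix_or_small #|T|.
rewrite -[X in _ <= X]add0n leq_add2r leqn0 cards_eq0 => /eqP ->.
by apply/eqP; rewrite -subset0 FW.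
Qed.

(** The level-0 vertices of the current graph on [W] are those without an
    in-neighbour in [W]. *)
Lemma vrsp_removedP G H (W : {set vertex_of (intermediate_product G H)}) w :
  w \in vrsp_removed W <->
  [/\ w \in W, (w : vertex_of (cartesian_product G H)) \notin sources _
    & forall u l, u \in W -> ~ has_arc u w l].
Proof.
split=> [/imsetP[w' + ->]|[wW ns nu]].
  rewrite inE lt0n !level_eq0 => /andP[/sourcesP h ns]; split=> //; first exact: (valP w').
  by move=> u l uW uw; apply: (h (exist _ u uW) l); apply/has_arc_vertex_induced.
apply/imsetP; exists (exist _ w wW) => //; rewrite inE lt0n !level_eq0 ns andbT.
apply/sourcesP => u l /has_arc_vertex_induced; exact: nu (valP u).
Qed.

(** Every surviving vertex is a source of the Cartesian product or has a
    surviving in-neighbour. *)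
Lemma vrsp_stable G H (w : vertex_of (intermediate_product G H)) :
  w \in vrsp_vertices G H ->
  (w : vertex_of (cartesian_product G H)) \notin sources _ ->
  exists u l, u \in vrsp_vertices G H /\ has_arc u w l.
Proof.
move=> wW ns.
have e : vrsp_vertices G H :\: vrsp_removed (vrsp_vertices G H) = vrsp_vertices G H.
  exact: (iter_deflationary_fix (F := fun W => W :\: vrsp_removed W)
           (fun W => subsetDl W _)).
have : w \notin vrsp_removed (vrsp_vertices G H) by move: wW; rewrite -{1}e inE => /andP[].
case: (pickP (fun a : arc_of (intermediate_product G H) =>
  (arc_tail a \in vrsp_vertices G H) && (arc_head a == w))) => [a /andP[aW /eqP <-] _|h].
  by exists (arc_tail a), (lab a); split=> //; exact: has_arc_mu.
case/negP; apply/vrsp_removedP; split=> // u l uW [a [ea _]].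
by have := h a; rewrite /arc_tail /arc_head ea uW eqxx.
Qed.

(** Conversely, all vertices of a set in which every vertex is a source of the
    Cartesian product or has an in-neighbour in the set survive. *)
Lemma vrsp_closed G H (D : vertex_of (intermediate_product G H) -> Prop) :
  (forall w, D w -> (w : vertex_of (cartesian_product G H)) \notin sources _ ->
     exists u l, D u /\ has_arc u w l) ->
  forall w, D w -> w \in vrsp_vertices G H.
Proof.
move=> hD; rewrite /vrsp_vertices; elim: #|_| => [|n IHn] w Dw; first by rewrite inE.
rewrite /= inE IHn // andbT; apply/negP => /vrsp_removedP[_ ns nu].
by have [u [l [Du uw]]] := hD w Dw ns; apply: (nu u l) uw; exact: IHn.
Qed.

(** * Cleanness *)

(** The ends of an arc of the induced subgraph are its ends in [G]. *)
Lemma arc_induced_mu G (B : {set arc_of G}) (a : arc_of (arc_induced B)) :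
  arc_tail (val a) = val (arc_tail a) /\ arc_head (val a) = val (arc_head a).
Proof. by rewrite /arc_tail /arc_head /= /sub_mu; case: (andP _). Qed.

(** In a clean bipartite graph, if a label pair occurs on an arc leaving some u
    in [X] and on an arc entering some v in [Y], then it occurs on an arc joining
    u and v, in one direction or the other. *)
Lemma clean_exchange G (A : {set arc_of G}) (X Y : {set vertex_of G}) (a b : arc_of G) :
  [disjoint X & Y] ->
  clean_bipartite (G := arc_induced A) [set v | val v \in X] [set v | val v \in Y] ->
  a \in A -> b \in A -> lab a = lab b -> arc_tail a \in X -> arc_head b \in Y ->
  exists2 c, c \in A & lab c = lab b /\
    (mu c = (arc_tail a, arc_head b) \/ mu c = (arc_head b, arc_tail a)).
Proof.
move=> XY [_ clean _] aA bA ab aX bY.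
pose a' : arc_of (arc_induced A) := exist _ a aA.
pose b' : arc_of (arc_induced A) := exist _ b bA.
have [V1 [V2 [[[_ _ _ V12 _] full] V1X V2Y]]] := clean (lab b) (ex_intro _ b' erefl).
have al : a' \in @arcs_labelled _ (arc_induced A) (lab b) by rewrite inE /= -ab.
have bl : b' \in @arcs_labelled _ (arc_induced A) (lab b) by rewrite inE.
pose a2 : arc_of (arc_induced (@arcs_labelled _ (arc_induced A) (lab b))) := exist _ a' al.
pose b2 : arc_of (arc_induced (@arcs_labelled _ (arc_induced A) (lab b))) := exist _ b' bl.
have ta : val (val (arc_tail a2)) = arc_tail a.
  by rewrite -(arc_induced_mu a2).1 -(arc_induced_mu a').1.
have hb : val (val (arc_head b2)) = arc_head b.
  by rewrite -(arc_induced_mu b2).2 -(arc_induced_mu b').2.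
have aV1 : arc_tail a2 \in V1.
  have : arc_tail a2 \in V1 :|: V2 by rewrite V12 inE.
  rewrite inE => /orP[//|/(imset_f val)/(subsetP V2Y)].
  by rewrite inE ta (disjointFr XY aX).
have bV2 : arc_head b2 \in V2.
  have : arc_head b2 \in V1 :|: V2 by rewrite V12 inE.
  rewrite inE => /orP[/(imset_f val)/(subsetP V1X)|//].
  by rewrite inE hb (disjointFl XY bY).
have [c ec] := full _ _ aV1 bV2.
exists (val (val c)); first exact: valP (val c).
split; first by have := valP c; rewrite inE => /eqP.
have muE : mu (val (val c)) = (val (val (arc_tail c)), val (val (arc_head c))).
  rewrite -(arc_induced_mu c).1 -(arc_induced_mu c).2.
  by rewrite -(arc_induced_mu (val c)).1 -(arc_induced_mu (val c)).2 -surjective_pairing.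
rewrite muE -ta -hb.
by case: ec => ec; [left|right]; rewrite {1}/arc_tail {1}/arc_head ec.
Qed.

End Arcs.

(** * Decomposing along a forward cut *)

Section Decomposition.
Variables (L : choiceType) (G : multidigraph L) (X Y : {set vertex_of G}).
Hypothesis G_acyclic : acyclic G.
Hypothesis Y_def : Y = ~: X.
Hypothesis XY_clean :
  clean_bipartite (G := arc_induced (arcs_between X Y))
    [set v | val v \in X] [set v | val v \in Y].
Hypothesis sync_GX : forall b : arc_of (contract X),
  synchronising (contract Y) b <->
  exists2 a : arc_of G, a \in arcs_between X Y & corresponds b a.
Hypothesis sync_GY : forall b : arc_of (contract Y),
  synchronising (contract X) b <->
  exists2 a : arc_of G, a \in arcs_between X Y & corresponds b a.
Hypothesis sources_X : sources G \subset X.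
Hypothesis XY_forward : no_backward X Y.

Let inY v : (v \in Y) = (v \notin X). Proof. by rewrite Y_def inE. Qed.

Let forward u v l : has_arc u v l -> v \in X -> u \in X.
Proof.
move=> [a [ea _]] vX; apply/negPn/negP => uX; have := XY_forward (a := a).
by rewrite inE /arc_tail /arc_head ea /= !inY uX vX orbT => /(_ isT).
Qed.

(** The images of a vertex in the two contractions; [None] is the contracted
    set, so [cY] is injective on [X] and constant on [Y], and [cX] the reverse. *)
Let cY : vertex_of G -> vertex_of (contract Y) := contract_vertex Y.
Let cX : vertex_of G -> vertex_of (contract X) := contract_vertex X.

Let cY_inj u v : v \in X -> cY u = cY v -> u = v.
Proof. by move=> vX; apply: contract_vertex_inj; rewrite inY vX. Qed.

Let cX_inj u v : v \notin X -> cX u = cX v -> u = v.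
Proof. exact: contract_vertex_inj. Qed.

Let cY_None v : v \notin X -> cY v = None.
Proof. by rewrite -inY; exact: contract_vertexE. Qed.

Let cX_None v : v \in X -> cX v = None.
Proof. exact: contract_vertexE. Qed.

(** The arcs of [G/Y] come from the arcs of [G] with tail in [X], and those of
    [G/X] from the arcs of [G] with head in [Y]. *)
Let arc_cY p q l : has_arc p q l <->
  exists u v, [/\ has_arc u v l, u \in X, p = cY u & q = cY v].
Proof.
rewrite has_arc_contract; split=> -[u [v [a uv -> ->]]]; exists u, v; split=> //.
  by move: uv; rewrite !inY negb_and !negbK => /orP[//|]; exact: forward a.
by rewrite !inY uv.
Qed.

Let arc_cX p q l : has_arc p q l <->
  exists u v, [/\ has_arc u v l, v \notin X, p = cX u & q = cX v].
Proof.
rewrite has_arc_contract; split=> -[u [v [a uv -> ->]]]; exists u, v; split=> //.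
  by move: uv; rewrite negb_and => /orP[|//]; apply: contraNN; exact: forward a.
by rewrite negb_and uv orbT.
Qed.

Let cross_label_X u v l : has_arc u v l -> v \notin X -> has_label (contract X) l.
Proof. by move=> a vX; apply: (@has_label_arc _ _ (cX u) (cX v)); apply/arc_cX; exists u, v. Qed.

Let cross_label_Y u v l : has_arc u v l -> u \in X -> has_label (contract Y) l.
Proof. by move=> a uX; apply: (@has_label_arc _ _ (cY u) (cY v)); apply/arc_cY; exists u, v. Qed.

Let between_head a : a \in arcs_between X Y -> (arc_tail a \in X) && (arc_head a \notin X).
Proof.
move=> aXY; move: (XY_forward aXY) (aXY); rewrite !inE inY => hX.
by rewrite (negbTE hX) andbF orbF => /andP[-> _].
Qed.

(** Arcs inside [X] are not synchronising. *)
Let inner_X u v l : has_arc u v l -> v \in X -> ~ has_label (contract X) l.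
Proof.
move=> uv vX; have uX := forward uv vX.
have [b [eb <-]] : has_arc (cY u) (cY v) l by apply/arc_cY; exists u, v.
move=> /synchronisingP/sync_GY[a /between_head/andP[_ aX] /corresponds_mu].
rewrite eb => -[_ /esym/(cY_inj vX) e].
by rewrite e vX in aX.
Qed.

(** Arcs inside [Y] are not synchronising. *)
Let inner_Y u v l : has_arc u v l -> u \notin X -> ~ has_label (contract Y) l.
Proof.
move=> uv uX; have vX : v \notin X by apply: contraNN uX; exact: forward uv.
have [b [eb <-]] : has_arc (cX u) (cX v) l by apply/arc_cX; exists u, v.
move=> /synchronisingP/sync_GX[a /between_head/andP[aX _] /corresponds_mu].
rewrite eb => -[/esym/(cX_inj uX) e _].
by rewrite e (negbTE uX) in aX.
Qed.

(** By cleanness, a label pair shared by an arc from [u] to [Y] and an arc from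
    [X] to [v] labels an arc from [u] to [v]. *)
Let cross u v v' u' l : has_arc u v' l -> u \in X -> v' \notin X ->
  has_arc u' v l -> u' \in X -> v \notin X -> has_arc u v l.
Proof.
move=> [a [ea la]] uX v'X [b [eb lb]] u'X vX.
have aXY : a \in arcs_between X Y by rewrite inE /arc_tail /arc_head ea !inY uX v'X.
have bXY : b \in arcs_between X Y by rewrite inE /arc_tail /arc_head eb !inY u'X vX.
have XY : [disjoint X & Y] by rewrite Y_def -subsets_disjoint.
have := clean_exchange XY XY_clean aXY bXY; rewrite la lb /arc_tail /arc_head ea eb !inY.
case=> // c cXY [lc [ec|ec]]; first by exists c.
by have := XY_forward cXY; rewrite /arc_head ec /= inY uX.
Qed.

(** The pair of images of a vertex in the two contractions. *)
Definition pair_image (u : vertex_of G) :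
    vertex_of (intermediate_product (contract Y) (contract X)) := (cY u, cX u).

Lemma pair_image_inj : injective pair_image.
Proof.
move=> u v [eY eX]; have [vX|vX] := boolP (v \in X); [exact: cY_inj eY|exact: cX_inj eX].
Qed.

(** The intermediate product induces a copy of [G] on the image of [V(G)]. *)
Lemma arc_product_image u v l :
  has_arc u v l <-> has_arc (pair_image u) (pair_image v) l.
Proof.
rewrite has_arc_intermediate; split=> [a|].
  have [vX|vX] := boolP (v \in X).
    have uX := forward a vX; constructor 1; split; last by rewrite !cX_None.
      by apply/arc_cY; exists u, v.
    exact: inner_X a vX.
  have [uX|uX] := boolP (u \in X).
    by constructor 3; split; [apply/arc_cY|apply/arc_cX]; exists u, v.
  constructor 2; split; last by rewrite !cY_None.
    by apply/arc_cX; exists u, v.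
  exact: inner_Y a uX.
case=> [[/arc_cY[u' [v' [a u'X eu ev]]] nl _]|[/arc_cX[u' [v' [a v'X eu ev]]] nl _]|].
- have v'X : v' \in X by apply/negPn/negP => v'X; apply: nl; exact: cross_label_X a v'X.
  by rewrite (cY_inj u'X eu) (cY_inj v'X ev).
- have u'X : u' \notin X by apply/negP => u'X; apply: nl; exact: cross_label_Y a u'X.
  by rewrite (cX_inj u'X eu) (cX_inj v'X ev).
- move=> [/arc_cY[u1 [v1 [a1 u1X eu _]]] /arc_cX[u2 [v2 [a2 v2X _ ev]]]].
  rewrite (cY_inj u1X eu) (cX_inj v2X ev); apply: (cross a1 _ _ a2) => //.
    by apply/negP => v1X; apply: (inner_X a1 v1X); exact: cross_label_X a2 v2X.
  apply/negPn/negP => u2X; apply: (inner_Y a2 u2X); exact: cross_label_Y a1 u1X.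
Qed.

Let in_arc_Y y : y \notin X -> exists u l, has_arc u y l.
Proof. by move=> yX; apply: not_sourcesP; apply: contraNN yX; exact: (subsetP sources_X). Qed.

(** No vertex (x, y) with x in [X] and y in [Y] survives. *)
Let no_mixed x y : x \in X -> y \notin X ->
  ((cY x, cX y) : vertex_of (intermediate_product _ _)) \notin
    vrsp_vertices (contract Y) (contract X).
Proof.
have [n] := ubnP (rank x + rank y); elim: n x y => // n IHn x y + xX yX.
rewrite ltnS => le_n; apply/negP => /vrsp_stable[|].
  (* [y] is not a source of [G], so its image is not a source of [G/X] *)
  have [u [l a]] := in_arc_Y yX.
  apply/negP => /sourcesP/(_ (cY x, cX u) l); apply; apply/has_arc_cartesian.
  by right; split=> //; apply/arc_cX; exists u, y.
move=> [p q] [l [pqW /has_arc_intermediate]] [].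
(* The in-neighbours of (x, y) come from a move inside [X] or a move inside [Y],
   hence have the same form and a smaller total rank; a joint move is excluded
   because arcs inside [X] are not synchronising. *)
- move=> [/arc_cY[u [v [a uX ep /esym/(cY_inj xX) ev]]] _ eq]; subst.
  move: pqW; apply/negP; apply: IHn => //; apply: leq_trans le_n.
  by rewrite ltn_add2r; exact: rank_lt a.
- move=> [/arc_cX[u [v [a vX eq /esym/(cX_inj yX) ev]]] nl ep]; subst.
  have [uX|uX] := boolP (u \in X); first by case: nl; exact: cross_label_Y a uX.
  move: pqW; apply/negP; apply: IHn => //; apply: leq_trans le_n.
  by rewrite ltn_add2l; exact: rank_lt a.
- move=> [/arc_cY[u [v [a uX _ /esym/(cY_inj xX) ev]]] a2]; subst.
  by apply: (inner_X a xX); exact: has_label_arc a2.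
Qed.

(** The vertex formed by the two contracted sets does not survive. *)
Let no_contracted :
  ((None, None) : vertex_of (intermediate_product (contract Y) (contract X)))
    \notin vrsp_vertices (contract Y) (contract X).
Proof.
have no_None u l : ~ @has_arc _ (contract X) u None l.
  by move=> /arc_cX[_ [v [_ vX _ /esym/contract_vertex_None]]]; rewrite (negbTE vX).
apply/negP => /vrsp_stable[|].
  (* the first partite set is nonempty, so there is an arc from [X] to [Y] *)
  have [[/set0Pn[[w]]] + _ _ _ _ _ _] := XY_clean.
  rewrite inE => /existsP[a /andP[/between_head/andP[tX hX] _]] _.
  apply/negP => /sourcesP/(_ (cY (arc_tail a), None) (lab a)); apply.
  apply/has_arc_cartesian; left; split=> //; apply/arc_cY.
  exists (arc_tail a), (arc_head a); split=> //; first exact: has_arc_mu.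
  by rewrite cY_None.
move=> [p q] [l [_ /has_arc_intermediate]] [].
- move=> [/arc_cY[u [v [a uX _ /esym/contract_vertex_None]]]].
  by rewrite inY => vX []; exact: cross_label_X a vX.
- by move=> [/no_None].
- by move=> [_ /no_None].
Qed.

(** The surviving vertices are the images of the vertices of [G]. *)
Lemma vrsp_image w :
  w \in vrsp_vertices (contract Y) (contract X) <-> exists u, w = pair_image u.
Proof.
split; last first.
  move: w; apply: (vrsp_closed (D := fun w => exists u, w = pair_image u)) => _ [v ->] ns.
  suff /not_sourcesP[u [l uv]] : v \notin sources G.
    by exists (pair_image u), l; split; [exists u|apply/arc_product_image].
  apply: contraNN ns => sv; have vX := subsetP sources_X _ sv.
  apply/sourcesP => -[p q] l /has_arc_cartesian[].
    move=> [/arc_cY[u [v' [a _ _ /esym/(cY_inj vX) e]]] _]; subst.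
    by have /sourcesP/(_ u l) := sv.
  move=> [_ /arc_cX[u [v' [_ v'X _ /(cX_inj v'X) e]]]].
  by rewrite -e vX in v'X.
have lift_Y (x : {v | v \notin Y}) : val x \in X /\ cY (val x) = Some x.
  by split; [have := valP x; rewrite inY negbK|exact: valK].
have lift_X (y : {v | v \notin X}) : val y \notin X /\ cX (val y) = Some y.
  by split; [exact: valP y|exact: valK].
case: w => [[x|] [y|]] wW.
- have [xX ex] := lift_Y x; have [yX ey] := lift_X y.
  by have := no_mixed xX yX; rewrite ex ey wW.
- by have [xX ex] := lift_Y x; exists (val x); rewrite /pair_image ex cX_None.
- by have [yX ey] := lift_X y; exists (val y); rewrite /pair_image ey cY_None.
- by have := no_contracted; rewrite wW.
Qed.

Lemma isomorphic_VRSP : isomorphic G (VRSP (contract Y) (contract X)).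
Proof.
have image_in u : pair_image u \in vrsp_vertices (contract Y) (contract X).
  by apply/vrsp_image; exists u.
pose phi u : vertex_of (VRSP (contract Y) (contract X)) :=
  exist (fun w => w \in vrsp_vertices (contract Y) (contract X)) _ (image_in u).
have phi_inj : injective phi by move=> u v /(congr1 val); exact: pair_image_inj.
have phi_surj w : exists u, phi u == w.
  have /vrsp_image[u e] := valP w.
  by exists u; apply/eqP/val_inj; rewrite [RHS]e.
exists phi; split; last first.
  by move=> u v l; exact: iff_trans (arc_product_image u v l)
    (iff_sym (has_arc_vertex_induced (phi u) (phi v) l)).
have phiK w : phi (xchoose (phi_surj w)) = w by exact/eqP/(xchooseP (phi_surj w)).
by exists (fun w => xchoose (phi_surj w)) => [u|//]; exact: phi_inj.
Qed.

End Decomposition.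

Theorem theorem6p1 (R : realType) (G : multidigraph (label_pair R))
    (X Y : {set vertex_of G})
    (G_acyclic : acyclic G)
    (G_connected : weakly_connected G)
    (X_nonempty : X != set0)
    (X_proper : X \proper [set: vertex_of G])
    (Y_def : Y = ~: X)
    (XY_clean :
      @clean_bipartite _ (arc_induced (arcs_between X Y))
        [set v | val v \in X] [set v | val v \in Y])
    (sync_GX : forall b : arc_of (contract X),
      synchronising (contract Y) b <->
      exists2 a : arc_of G, a \in arcs_between X Y & corresponds b a)
    (sync_GY : forall b : arc_of (contract Y),
      synchronising (contract X) b <->
      exists2 a : arc_of G, a \in arcs_between X Y & corresponds b a)
    (sources_X : sources G \subset X)
    (XY_forward : no_backward X Y) :
  isomorphic G (VRSP (contract Y) (contract X)).
Proof. exact: isomorphic_VRSP. Qed.
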